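(* (a) For every positive integer $d$, $$h_{\rm sep}(d)\leq H_{\rm sep}(d)\leq\max\{2\ell+h_{\rm sep}(d-\ell)\;:\;\ell=0,\ldots,d\}.$$ (b) $h_{\rm sep}(d)=d$ for $d\in\{1,2,3,4\}$. (c) $h_{\rm sep}(\mathbf{B}^d)=d$ for the $d$-dimensional Euclidean unit ball $\mathbf{B}^d$, for every positive integer $d$.
   Context: $\mathbb{E}^d$ is $d$-dimensional Euclidean space with origin $\mathbf{o}$. A convex body is a compact convex subset of $\mathbb{E}^d$ with nonempty interior. It is $\mathbf{o}$-symmetric if $\mathbf{K}=-\mathbf{K}$; smooth if at every boundary point it is supported by a unique hyperplane; strictly convex if its boundary contains no nontrivial line segment. A packing of translates of $\mathbf{K}$ is a family of translates with pairwise disjoint interiors; two members touch if they intersect. A packing of translates of $\mathbf{K}$ is totally separable if any two members can be separated by a hyperplane of $\mathbb{E}^d$ that is disjoint from the interior of every member of the packing. A separable Hadwiger configuration of $\mathbf{K}$ is a family of translates of $\mathbf{K}$ that all touch $\mathbf{K}$ and, together with $\mathbf{K}$, form a totally separable packing in $\mathbb{E}^d$. The separable Hadwiger number $H_{\rm sep}(\mathbf{K})$ is the maximum size of a separable Hadwiger configuration of $\mathbf{K}$ (the body $\mathbf{K}$ itself is not counted). For a smooth $\mathbf{o}$-symmetric convex body $\mathbf{K}$ in $\mathbb{E}^d$, the one-sided separable Hadwiger number $h_{\rm sep}(\mathbf{K})$ is the maximum number $n$ of translates $2\mathbf{x}_1+\mathbf{K},\ldots,2\mathbf{x}_n+\mathbf{K}$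 of $\mathbf{K}$ that form a separable Hadwiger configuration of $\mathbf{K}$ and satisfy the following: if $f_1,\ldots,f_n$ denote the supporting linear functionals of $\mathbf{K}$ at the points $\mathbf{x}_1,\ldots,\mathbf{x}_n$ respectively (that is, $f_i(\mathbf{x}_i)=1$ and $-1\le f_i\le 1$ on $\mathbf{K}$), then $\mathbf{o}\notin\mathrm{conv}\{\mathbf{x}_1,\ldots,\mathbf{x}_n\}$ and $\mathbf{o}\notin\mathrm{conv}\{f_1,\ldots,f_n\}$ (in the latter, $\mathbf{o}$ is the zero functional). For a positive integer $d$, $h_{\rm sep}(d)$ is the maximum of $h_{\rm sep}(\mathbf{K})$, and $H_{\rm sep}(d)$ is the maximum of $H_{\rm sep}(\mathbf{K})$, over all $\mathbf{o}$-symmetric, smooth and strictly convex bodies $\mathbf{K}$ in $\mathbb{E}^d$. By convention $H_{\rm sep}(0)=h_{\rm sep}(0)=0$. *)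

(* Defs.v *)
From HB Require Import structures.
From mathcomp Require Export all_boot all_order all_algebra.
From mathcomp Require Export all_classical all_reals all_analysis.
Export numFieldNormedType.Exports.
Export Order.TTheory GRing.Theory Num.Theory.

Set Implicit Arguments.
Unset Strict Implicit.
Unset Printing Implicit Defensive.

Local Open Scope classical_set_scope.
Local Open Scope ring_scope.

Section Maximum.

Definition is_max (A : set nat) (n : nat) : Prop :=
  A n /\ forall m, A m -> (m <= n)%N.

(* Total function: it is 0 when [A] has no maximum. *)
Definition nat_max (A : set nat) : nat := xget 0%N (is_max A).

End Maximum.

Section Hull.
Variables (R : realType) (E : lmodType R).

Definition conv_hull (n : nat) (p : 'I_n -> E) : set E :=
  [set y | exists w : 'I_n -> R,
     [/\ forall i, 0 <= w i, \sum_i w i = 1 & y = \sum_i w i *: p i]].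

End Hull.

Section Bodies.
Variables (R : realType) (d : nat).

(* The topology carried by row vectors is the product topology, which is the
   Euclidean one. *)
Local Notation E := 'rV[R]_d.


Implicit Types (K A : set E) (f : 'Hom('rV[R]_d, R^o)).

Definition boundary A : set E := closure A `\` interior A.

Definition segment (x y : E) : set E :=
  [set (1 - s) *: x + s *: y | s in `[0, 1]%classic].

Definition translate (t : E) K : set E := [set t + x | x in K].

(* A hyperplane of E is a set [hyperplane f c] with [f != 0]. *)
Definition hyperplane f (c : R) : set E := [set x | f x = c].

Definition convex_body K : Prop :=
  [/\ compact K, convex_set K & interior K !=set0].

Definition o_symmetric K : Prop := K = [set - x | x in K].

Definition supporting_hyperplane K (x : E) (H : set E) : Prop :=
  exists f c, [/\ f != 0, H = hyperplane f c, H x & forall y, K y -> f y <= c].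

Definition smooth K : Prop :=
  forall x, boundary K x -> exists! H, supporting_hyperplane K x H.

Definition strictly_convex K : Prop :=
  forall x y, segment x y `<=` boundary K -> x = y.

Definition supporting_functional K (x : E) f : Prop :=
  f x = 1 /\ forall y, K y -> -1 <= f y <= 1.

Definition touch A B : Prop := (A `&` B : set E) !=set0.

(* Families of translates are given by the indexed translation vectors. *)
Definition packing (I : Type) K (t : I -> E) : Prop :=
  forall i j, i <> j ->
    interior (translate (t i) K) `&` interior (translate (t j) K) = set0.

Definition totally_separable_packing (I : Type) K (t : I -> E) : Prop :=
  packing K t /\
  forall i j, i <> j -> exists f c,
    [/\ f != 0,
        forall x, translate (t i) K x -> f x <= c,
        forall x, translate (t j) K x -> c <= f x &
        forall k, hyperplane f c `&` interior (translate (t k) K) = set0].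

(* The index [None] stands for the body [K] itself. *)
Definition with_origin (n : nat) (t : 'I_n -> E) (o : option 'I_n) : E :=
  if o is Some i then t i else 0.

Definition sep_hadwiger_config K (n : nat) (t : 'I_n -> E) : Prop :=
  (forall i, touch (translate (t i) K) K) /\
  totally_separable_packing K (with_origin t).

Definition one_sided_config K (n : nat) (x : 'I_n -> E) : Prop :=
  [/\ sep_hadwiger_config K (fun i => 2 *: x i),
      ~ conv_hull x 0 &
      forall f : 'I_n -> 'Hom('rV[R]_d, R^o),
        (forall i, supporting_functional K (x i) (f i)) -> ~ conv_hull f 0].

Definition Hsep_sizes K : set nat :=
  [set n | exists t : 'I_n -> E, sep_hadwiger_config K t].

Definition hsep_sizes K : set nat :=
  [set n | exists x : 'I_n -> E, one_sided_config K x].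

Definition Hsep_body K : nat := nat_max (Hsep_sizes K).

Definition hsep_body K : nat := nat_max (hsep_sizes K).

Definition regular_body K : Prop :=
  [/\ convex_body K, o_symmetric K, smooth K & strictly_convex K].

Definition Hsep_values : set nat := [set Hsep_body K | K in regular_body].

Definition hsep_values : set nat := [set hsep_body K | K in regular_body].

Definition enorm (x : E) : R := Num.sqrt (\sum_i x 0 i ^+ 2).

Definition unit_ball : set E := [set x | enorm x <= 1].

End Bodies.

Arguments unit_ball R d : clear implicits.

Definition Hsep (R : realType) (d : nat) : nat :=
  if d == 0%N then 0%N else nat_max (Hsep_values R d).

Definition hsep (R : realType) (d : nat) : nat :=
  if d == 0%N then 0%N else nat_max (hsep_values R d).

(* Main.v *)
From HB Require Import structures.
Require Import Defs.
From mathcomp Require Import zify ring lra.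
Set Implicit Arguments.
Unset Strict Implicit.
Unset Printing Implicit Defensive.
Local Open Scope classical_set_scope.
Local Open Scope ring_scope.

(** Everything reduces to linear algebra. A member of a packing that touches [K]
    has the form [2 x + K] with [x] in the boundary of [K], and a hyperplane
    separating it from [K] is a level set [a = 1] of a functional [a] supporting
    [K] at [x]. Such a hyperplane avoids the interior of another member [2 y + K]
    of the packing exactly when [a(y) <= 0]. A separable Hadwiger configuration is therefore a
    family of points [x_i] with supporting functionals [a_i] such that
    [a_j(x_i) <= 0] for [i != j] ([config_sep_system], [sep_system_config]).
    Functionals are represented by vectors through [dot].

    The maxima exist because [a_i(x_i - x_j) >= 1] keeps the points apart, and a
    pigeonhole argument bounds the number of such points by a constant depending
    only on the dimension ([close_rows], [sep_system_bounded]).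

    For the upper bound on [Hsep], suppose that the origin is in the convex hull of
    the [x_i], and take a positive relation between some of them with minimal
    support [T]. These points span a space of dimension [l = #|T| - 1 >= 1], so
    [#|T| <= 2 l]. Evaluating the relation at [a_k] with [k] outside [T] gives a
    sum of nonpositive terms equal to zero, so [a_k] vanishes on that space.
    Hence the members outside [T] form a configuration of the projection of [K]
    along it, a body of dimension [d - l]. When the origin is in the convex hull of
    the [a_i], the same argument with points and functionals exchanged leads to a
    section of [K] of dimension [d - l]. Sections and projections of smooth
    strictly convex bodies are smooth and strictly convex, by the Hahn-Banach
    theorem ([section_body_regular], [projection_body_regular]). Repeating this
    until the configuration is one-sided, or the dimension is zero, gives the
    bound ([sep_system_size_le]).

    For the one-sided numbers, more than [d] points satisfy a linear relation; let
    [u] be the sum of its terms with positive coefficients, which is also the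
    opposite of the sum of its other terms. Writing [u] in the way that does not
    involve [x_k] shows [a_k(u) <= 0] for every [k]. In the ball, [a_k = x_k] and
    so [dot u u <= 0], which puts the origin in the hull of the [x_k]
    ([obtuse_size_le]). In a general body, comparing coefficients shows that
    there are at least three positive and, by symmetry, three negative
    coefficients ([positive_support_gt2]), so that [d + 1 >= 6] when the relation
    is taken between [d + 1] points. The standard basis of the Euclidean ball shows
    that [d] is attained. *)

(** * The pairing of vectors with functionals, and convex combinations *)

Section Dot.
Variables (R : realType).
Implicit Types d m n : nat.

Definition dot d (x a : 'rV[R]_d) : R := (x *m a^T) 0 0.

Lemma dotE d (x a : 'rV[R]_d) : dot x a = \sum_i x 0 i * a 0 i.
Proof. by rewrite /dot mxE; apply: eq_bigr => i _; rewrite mxE. Qed.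

Lemma dotC d (x a : 'rV[R]_d) : dot x a = dot a x.
Proof. by rewrite !dotE; apply: eq_bigr => i _; rewrite mulrC. Qed.

(** [dot] with the functional as first argument and values in [R^o], the form
    in which it can carry a linear structure. *)
Definition pairing d (a x : 'rV[R]_d) : R^o := dot x a.

Lemma pairing_is_linear d (a : 'rV[R]_d) : linear (pairing a).
Proof. by move=> k x y; rewrite /pairing /dot mulmxDl -scalemxAl !mxE. Qed.

HB.instance Definition _ d (a : 'rV[R]_d) :=
  GRing.isLinear.Build R 'rV[R]_d R^o _ (pairing a) (@pairing_is_linear d a).

Lemma dotDl d (x y a : 'rV[R]_d) : dot (x + y) a = dot x a + dot y a.
Proof. by rewrite /dot mulmxDl mxE. Qed.

Lemma dotZl d k (x a : 'rV[R]_d) : dot (k *: x) a = k * dot x a.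
Proof. by rewrite /dot -scalemxAl mxE. Qed.

Lemma dotNl d (x a : 'rV[R]_d) : dot (- x) a = - dot x a.
Proof. by rewrite -scaleN1r dotZl mulN1r. Qed.

Lemma dot0l d (a : 'rV[R]_d) : dot 0 a = 0.
Proof. by rewrite /dot mul0mx mxE. Qed.

Lemma dot_suml d n (P : pred 'I_n) (x : 'I_n -> 'rV[R]_d) (a : 'rV[R]_d) :
  dot (\sum_(i | P i) x i) a = \sum_(i | P i) dot (x i) a.
Proof. exact: (linear_sum (pairing a)). Qed.

Lemma dotZr d k (x a : 'rV[R]_d) : dot x (k *: a) = k * dot x a.
Proof. by rewrite ![dot x _]dotC dotZl. Qed.

Lemma dot_mulmx m n (x : 'rV[R]_m) (B : 'M[R]_(m, n)) (a : 'rV[R]_n) :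
  dot (x *m B) a = dot x (a *m B^T).
Proof. by rewrite /dot trmx_mul trmxK mulmxA. Qed.

Lemma dot_ge0 d (x : 'rV[R]_d) : 0 <= dot x x.
Proof. by rewrite dotE sumr_ge0 // => i _; rewrite -expr2 sqr_ge0. Qed.

Lemma dot_eq0 d (x : 'rV[R]_d) : dot x x = 0 -> x = 0.
Proof.
rewrite dotE => H; apply/rowP => i; rewrite mxE.
have /eqP : x 0 i * x 0 i = 0.
  by apply: (psumr_eq0P _ H) => // j _; rewrite -expr2 sqr_ge0.
by rewrite mulf_eq0 orbb => /eqP.
Qed.

Lemma dot_inj d (a b : 'rV[R]_d) : (forall x, dot x a = dot x b) -> a = b.
Proof.
move=> H; apply/rowP => i; have := H (delta_mx 0 i).
by rewrite ![dot (delta_mx _ _) _]dotC /dot trmx_delta -!colE !mxE.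
Qed.

(** Nonnegative weights with a positive entry can be rescaled to sum to one. *)
Lemma conv_hull0 (E : lmodType R) n (v : 'I_n -> E) (w : 'I_n -> R) k :
  (forall i, 0 <= w i) -> 0 < w k -> \sum_i w i *: v i = 0 ->
  conv_hull v 0.
Proof.
move=> w0 wk Hs; set s := \sum_i w i.
have s0 : 0 < s by rewrite /s (bigD1 k) //= ltr_pwDl // sumr_ge0.
exists (fun i => w i / s); split.
- by move=> i; rewrite divr_ge0 // ltW.
- by rewrite -mulr_suml divff // gt_eqF.
- transitivity (s^-1 *: \sum_i w i *: v i); first by rewrite Hs scaler0.
  by rewrite scaler_sumr; apply: eq_bigr => i _; rewrite scalerA mulrC.
Qed.

Lemma conv_hull_reindex (E : lmodType R) m n (g : 'I_m -> 'I_n) (v : 'I_n -> E) y :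
  conv_hull (v \o g) y -> conv_hull v y.
Proof.
move=> [w [w0 w1 ->]].
exists (fun j => \sum_(i | g i == j) w i); split.
- by move=> j; apply: sumr_ge0.
- by rewrite -w1 [RHS](partition_big g predT).
- rewrite [LHS](partition_big g predT) //=; apply: eq_bigr => j _.
  by rewrite scaler_suml; apply: eq_bigr => i /eqP <-.
Qed.

Lemma convex_weight_gt0 n (w : 'I_n -> R) :
  (forall i, 0 <= w i) -> \sum_i w i = 1 -> exists k, 0 < w k.
Proof.
move=> w0 w1; apply: contrapT => H; have : \sum_i w i = 0.
  apply: big1 => i _; apply/eqP; move: (w0 i); rewrite le_eqVlt => /orP[/eqP<-//|wi].
  by case: H; exists i.
by rewrite w1 => /eqP; rewrite oner_eq0.
Qed.

Lemma matrix_dependence n d (v : 'I_n -> 'rV[R]_d) : (d < n)%N ->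
  exists mu : 'I_n -> R, (exists k, mu k != 0) /\ \sum_i mu i *: v i = 0.
Proof.
move=> dn; pose V := \matrix_i v i.
have : kermx V != 0.
  by rewrite -mxrank_eq0 mxrank_ker subn_eq0 -ltnNge (leq_ltn_trans (rank_leq_col _)).
move=> kerV0; have [i [j Hij]] : exists i j, kermx V i j != 0.
  apply: contrapT => H; case/eqP: kerV0; apply/matrixP => i j.
  by rewrite [RHS]mxE; apply: contrapT => /eqP Hij; apply: H; exists i, j.
exists (fun j => kermx V i j); split; first by exists j.
have ker_i : row i (kermx V) *m V = 0 by rewrite -row_mul mulmx_ker row0.
apply: etrans ker_i; rewrite mulmx_sum_row.
by apply: eq_bigr => k _; rewrite rowK [row _ _ _ _]mxE.
Qed.

End Dot.

(** * Relations with minimal support, and close rows *)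

Section Relations.
Variables (R : realType).

(** Among the nonnegative nontrivial relations take one with the fewest positive
    coefficients. If [mu] is another relation on the same support, subtract from
    it the multiple of [lam] given by the least ratio [mu i / lam i]: what is left
    is nonnegative and loses a support element, hence vanishes. *)
Lemma minimal_relation d n (v : 'I_n -> 'rV[R]_d) : conv_hull v 0 ->
  exists lam : 'I_n -> R,
    [/\ forall i, 0 <= lam i, exists k, 0 < lam k,
        \sum_i lam i *: v i = 0 &
        forall mu : 'I_n -> R, (forall i, lam i = 0 -> mu i = 0) ->
          \sum_i mu i *: v i = 0 -> exists c, forall i, mu i = c * lam i].
Proof.
move=> [w [w0 w1 wv]].
pose Q (lam : 'I_n -> R) := [/\ forall i, 0 <= lam i, exists k, 0 < lam k &
  \sum_i lam i *: v i = 0].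
pose P m := `[< exists lam, Q lam /\ #|[pred i | 0 < lam i]| = m >].
have exP : exists m, P m.
  exists #|[pred i | 0 < w i]|; apply/asboolP; exists w; split=> //; split=> //.
  exact: convex_weight_gt0.
case: (ex_minnP exP) => m /asboolP[lam [[lam0 [k0 lamk0] lamv] <-]] minm.
exists lam; split=> //; first by exists k0.
move=> mu supp muv.
case: (@arg_minP _ _ _ k0 (fun i => 0 < lam i) (fun i => mu i / lam i) lamk0) => k lamk kmin.
set c := mu k / lam k in kmin; exists c => i; apply/eqP; rewrite -subr_eq0; apply/eqP.
pose nu i := mu i - c * lam i.
have nu0 j : 0 <= nu j.
  rewrite /nu; move: (lam0 j); rewrite le_eqVlt => /orP[/eqP lj|lj].
    by rewrite -lj supp // mulr0 subr0.
  by rewrite subr_ge0 -ler_pdivlMr // kmin.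
have nuv : \sum_i nu i *: v i = 0.
  under eq_bigr do rewrite scalerBl -scalerA.
  by rewrite sumrB -scaler_sumr lamv muv scaler0 subr0.
apply: contrapT => nui.
have /minm : P #|[pred i | 0 < nu i]|.
  apply/asboolP; exists nu; split=> //; split=> //.
  by exists i; rewrite lt_neqAle nu0 eq_sym; apply/andP; split=> //; apply/eqP.
apply/negP; rewrite -ltnNge; apply: proper_card; apply/properP; split.
  apply/fintype.subsetP => j; rewrite !inE => nuj; rewrite lt_neqAle lam0 andbT eq_sym.
  by apply/eqP => lj; move: nuj; rewrite /nu lj supp // mulr0 subrr ltxx.
exists k; rewrite !inE // /nu /c divfK ?subrr ?ltxx //.
by rewrite gt_eqF.
Qed.

(** Let [T] be the support of a minimal relation. All relations on [T] being
    proportional, the vectors indexed by [T] span a space of dimension [#|T| - 1],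
    which is at least one, whence the factor two. Pairing the relation with [w k]
    for [k] outside [T] gives a vanishing sum of terms of one sign, so [w k] is
    orthogonal to that span; the rows of [B] are a basis of its orthogonal
    complement, and [b k] lists the coordinates of [w k] in it. *)
Lemma orthogonal_reduction d n (v w : 'I_n -> 'rV[R]_d) :
  (forall i, dot (v i) (w i) = 1) ->
  (forall i j, i != j -> dot (v i) (w j) <= 0) ->
  conv_hull v 0 ->
  exists (T : {pred 'I_n}) (r : nat) (B : 'M[R]_(r, d)) (b : 'I_n -> 'rV[R]_r),
    [/\ row_free B, (r < d)%N, (#|T| <= 2 * (d - r))%N &
        forall k, k \notin T -> w k = b k *m B].
Proof.
move=> diag off /minimal_relation [lam [lam0 [k0 lamk0] lamv uniq_lam]].
pose T : {pred 'I_n} := [pred i | 0 < lam i].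
pose V := \matrix_(i < #|T|) v (enum_val i).
have rV0 : (0 < \rank V)%N.
  rewrite lt0n mxrank_eq0; apply/eqP => /(congr1 (row (enum_rank_in lamk0 k0))).
  rewrite row0 rowK enum_rankK_in // => vk0; move: (diag k0).
  by rewrite vk0 dot0l => /esym/eqP; rewrite oner_eq0.
(* The row kernel of [V] is contained in the line spanned by [lam]. *)
have rV1 : (#|T| <= \rank V + 1)%N.
  rewrite -leq_subLR -mxrank_ker.
  pose L := \row_(i < #|T|) lam (enum_val i).
  apply: leq_trans (rank_leq_row L); apply: mxrankS.
  apply/row_subP => i; set u := row i _.
  have uV : u *m V = 0.
    by rewrite /u -row_mul mulmx_ker row0.
  pose mu j := \sum_(i < #|T| | enum_val i == j) u 0 i.
  have [||c muc] := uniq_lam mu.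
  - move=> j lj; apply: big_pred0 => l; apply/eqP => lE.
    have : enum_val l \in T by apply: enum_valP.
    by rewrite inE lE lj ltxx.
  - apply: etrans uV; apply: esym.
    rewrite mulmx_sum_row [LHS](partition_big (@enum_val _ T) predT) //=.
    apply: eq_bigr => j _; rewrite scaler_suml.
    by apply: eq_bigr => l /eqP <-; rewrite rowK.
  have -> : u = c *: L; last exact: scalemx_sub.
  apply/rowP => l; rewrite [RHS]mxE [L _ _]mxE -muc /mu.
  rewrite (eq_bigl (pred1 l)) ?big_pred1_eq // => l' /=.
  by rewrite (inj_eq enum_val_inj).
pose B := row_base (kermx V^T).
have rB : \rank (kermx V^T) = (d - \rank V)%N by rewrite mxrank_ker mxrank_tr.
have orth k : k \notin T -> (w k <= B)%MS.
  move=> kT; rewrite eq_row_base; apply/sub_kermxP.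
  have lk : lam k = 0.
    by move: kT; rewrite inE lt_neqAle lam0 andbT negbK eq_sym => /eqP.
  have S0 : \sum_i - dot (lam i *: v i) (w k) = 0.
    by rewrite sumrN -dot_suml lamv dot0l oppr0.
  apply/rowP => i; rewrite [RHS]mxE.
  have -> : (w k *m V^T) 0 i = dot (v (enum_val i)) (w k).
    by rewrite dotC /dot !mxE; apply: eq_bigr => j _; rewrite !mxE.
  have : - dot (lam (enum_val i) *: v (enum_val i)) (w k) = 0.
    apply: (psumr_eq0P _ S0) => // j _; rewrite oppr_ge0 dotZl.
    case: (eqVneq j k) => [->|jk]; first by rewrite lk mul0r.
    by rewrite mulr_ge0_le0 // off.
  move/eqP; rewrite oppr_eq0 dotZl mulf_eq0 => /orP[/eqP li|/eqP //].
  have : enum_val i \in T by apply: enum_valP.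
  by rewrite inE li ltxx.
have rVd : (\rank V <= d)%N by apply: rank_leq_col.
exists T, _, B, (fun k => w k *m pinvmx B); split.
- exact: row_base_free.
- by rewrite rB; lia.
- by rewrite rB; lia.
- by move=> k /orth kB; rewrite mulmxKpV.
Qed.

(** Many points of a bounded set include two close ones; measuring size and
    distance by the values [Y *m G] makes the bound independent of [G]. By
    induction on the dimension: subtracting multiples of the row whose first entry
    is largest clears the first column. The multipliers have absolute value at
    most one, so the bound on the values at most doubles, and among the rows whose
    multipliers fall in one small cell the subtracted parts are close. *)
Lemma close_rows d (M e : R) : 0 < M -> 0 < e -> exists N, forall n p
    (Y : 'M[R]_(n, d)) (G : 'M[R]_(d, p)), (N < n)%N ->
    (forall i k, `|(Y *m G) i k| <= M) ->
  exists i j, i != j /\ forall k, `|(Y *m G) i k - (Y *m G) j k| < e.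
Proof.
elim: d M e => [|d IH] M e M0 e0.
  exists 1%N => n p Y G n1 _; exists (Ordinal (ltnW n1)), (Ordinal n1); split=> //.
  by move=> k; rewrite !mxE !big_ord0 subrr normr0.
have [||N HN] := IH (M *+ 2) (e / 2); rewrite ?mulrn_wgt0 ?divr_gt0 //.
pose q := (Num.truncn (M / (e / 2))).+1.
have qM : M / (e / 2) < q%:R.
  by apply: truncnS_gt.
exists ((2 * q).+1 * N)%N => n p Y G nN bd.
have n0 : (0 < n)%N by apply: leq_ltn_trans nN.
have [i0 imax] : exists i0, forall i, `|Y i 0| <= `|Y i0 0|.
  case: (@arg_maxP _ _ _ (Ordinal n0) predT (fun i => `|Y i 0|) isT) => i _ H.
  by exists i => j; apply: H.
pose c i := Y i 0 / Y i0 0.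
have c1 i : `|c i| <= 1.
  rewrite /c normf_div; case: (eqVneq (Y i0 0) 0) => [->|y0].
    by rewrite normr0 invr0 mulr0.
  by rewrite ler_pdivrMr ?normr_gt0 // mul1r.
have cY i : Y i 0 = c i * Y i0 0.
  rewrite /c; case: (eqVneq (Y i0 0) 0) => [y0|y0]; last by rewrite divfK.
  by rewrite y0 mulr0; apply/eqP; rewrite -normr_le0 (le_trans (imax i)) // y0 normr0.
pose Z : 'M[R]_(n, d) := \matrix_(i, j) (Y i (lift 0 j) - c i * Y i0 (lift 0 j)).
pose H : 'M[R]_(d, p) := \matrix_(i, j) G (lift 0 i) j.
have ZH i k : (Z *m H) i k = (Y *m G) i k - c i * (Y *m G) i0 k.
  rewrite !mxE !big_ord_recl /= cY.
  under eq_bigr do rewrite !mxE mulrBl -mulrA.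
  rewrite sumrB -mulr_sumr mulrDr; ring.
pose cell i := inord (Num.truncn ((c i + 1) * q%:R)) : 'I_(2 * q).+1.
have cp l : 0 <= (c l + 1) * q%:R.
  by move: (c1 l); rewrite ler_norml => /andP[? ?]; rewrite mulr_ge0 //; lra.
have cellE i : nat_of_ord (cell i) = Num.truncn ((c i + 1) * q%:R).
  rewrite inordK // ltnS -(@ler_nat R).
  apply: (@le_trans _ _ ((c i + 1) * q%:R)); first by rewrite truncn_le.
  rewrite natrM ler_wpM2r //.
  by move: (c1 i); rewrite ler_norml => /andP[? ?]; lra.
have [s Ns] : exists s, (N < #|[pred i | cell i == s]|)%N.
  apply: contrapT => Hs; have: (n <= (2 * q).+1 * N)%N.
    rewrite -[X in (X <= _)%N]card_ord -sum1_card (partition_big cell predT) //=.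
    rewrite -[X in (_ <= X * _)%N]card_ord -sum_nat_const leq_sum // => s _.
    by rewrite sum1_card leqNgt; apply/negP => ?; apply: Hs; exists s.
  by rewrite leqNgt nN.
pose f (i : 'I_#|[pred i | cell i == s]|) := enum_val i.
have fE i k : (rowsub f Z *m H) i k = (Y *m G) (f i) k - c (f i) * (Y *m G) i0 k.
  by rewrite -ZH !mxE; apply: eq_bigr => l _; rewrite !mxE.
have [|i [j [ij close]]] := HN _ p (rowsub f Z) H Ns.
  move=> i k; rewrite fE (le_trans (ler_normB _ _)) // mulr2n lerD //.
  by rewrite normrM -[M]mul1r ler_pM.
exists (f i), (f j); split; first by rewrite (inj_eq enum_val_inj).
move=> k; have := close k; rewrite !fE.
have same : cell (f i) = cell (f j).
  by have /eqP -> := enum_valP i; have /eqP -> := enum_valP j.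
have cij : `|c (f i) - c (f j)| * q%:R < 1.
  have := congr1 (@nat_of_ord _) same; rewrite !cellE => tE.
  have /andP[a1 a2] := truncn_itv (cp (f i)).
  have /andP[b1 b2] := truncn_itv (cp (f j)).
  rewrite -[q%:R]ger0_norm // -normrM ltr_norml; rewrite tE in a1 a2.
  by rewrite -natr1 in a2 b2; apply/andP; split; lra.
have q0 : 0 < q%:R :> R by rewrite ltr0n.
set A := (Y *m G) i0 k => HA.
have AM : `|A| <= M by apply: bd.
have cA : `|(c (f i) - c (f j)) * A| < e / 2.
  rewrite normrM (le_lt_trans (ler_wpM2l _ AM)) // -(ltr_pM2r q0).
  rewrite mulrAC (lt_trans _ (_ : M < _)) //.
    by rewrite -[X in _ < X]mul1r ltr_pM2r.
  by move: qM; rewrite ltr_pdivrMr ?divr_gt0 // mulrC.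
have -> : (Y *m G) (f i) k - (Y *m G) (f j) k =
  ((Y *m G) (f i) k - c (f i) * A - ((Y *m G) (f j) k - c (f j) * A))
  + (c (f i) - c (f j)) * A by ring.
by rewrite [e]splitr (le_lt_trans (ler_normD _ _)) // ltrD.
Qed.

End Relations.

(** * Extension of functionals dominated by one on a convex set *)

Section HahnBanach.
Variables (R : realType) (d : nat) (K : set 'rV[R]_d).
Hypothesis K_convex : forall x y s, 0 <= s <= 1 -> K x -> K y ->
  K (s *: x + (1 - s) *: y).
Hypothesis K_absorbing : forall y, exists2 e, 0 < e & K (e *: y).

(** One step of the Hahn-Banach extension. The value at [v] has to lie above the
    slopes in [L] and below the slopes coming from the other side of [U]; convexity
    puts the former below the latter, so the supremum of [L] will do. *)
Lemma hahn_banach_step m (U : 'M[R]_(m, d)) (v b : 'rV[R]_d) :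
  ~~ (v <= U)%MS ->
  (forall y, K y -> (y <= U)%MS -> dot y b <= 1) ->
  exists b', (forall y, (y <= U)%MS -> dot y b' = dot y b) /\
    forall y, K y -> (y <= U + v)%MS -> dot y b' <= 1.
Proof.
rewrite submxE => vU bU.
have [c [cU cv]] : exists c, (forall y, (y <= U)%MS -> dot y c = 0) /\ dot v c = 1.
  have [j vj] : exists j, (v *m cokermx U) 0 j != 0.
    apply: contrapT => H; case/eqP: vU; apply/rowP => j.
    by rewrite [RHS]mxE; apply: contrapT => /eqP vj; apply: H; exists j.
  have colE y : dot y (col j (cokermx U))^T = (y *m cokermx U) 0 j.
    by rewrite /dot trmxK colE mulmxA -colE mxE.
  exists (((v *m cokermx U) 0 j)^-1 *: (col j (cokermx U))^T); split.
    move=> y; rewrite submxE => /eqP yU; rewrite dotZr colE yU.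
    by rewrite [X in _ * X]mxE mulr0.
  by rewrite dotZr colE mulVf.
pose L := [set r | exists y s, [/\ (y <= U)%MS, 0 < s, K (y - s *: v) &
  r = (dot y b - 1) / s]].
have LU r y s : L r -> (y <= U)%MS -> 0 < s -> K (y + s *: v) ->
    r <= (1 - dot y b) / s.
  move=> [y' [s' [y'U s'0 Ky' ->]]] yU s0 Ky.
  have ss0 : 0 < s + s' by apply: addr_gt0.
  (* The point where the segment from [y' - s' v] to [y + s v] meets [U]. *)
  have : dot ((s / (s + s')) *: y' + (s' / (s + s')) *: y) b <= 1.
    apply: bU; last by rewrite addmx_sub ?scalemx_sub.
    have -> : (s / (s + s')) *: y' + (s' / (s + s')) *: y =
      (s / (s + s')) *: (y' - s' *: v) + (1 - s / (s + s')) *: (y + s *: v).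
      have -> : 1 - s / (s + s') = s' / (s + s').
        by field; rewrite gt_eqF.
      rewrite scalerBr scalerDr !scalerA addrACA.
      rewrite [X in _ + _ + (- X + _)](_ : _ = (s' / (s + s') * s) *: v); last first.
        by congr (_ *: _); ring.
      by rewrite addNr addr0.
    apply: K_convex => //; rewrite divr_ge0 ?(ltW s0) ?(ltW ss0) //=.
    by rewrite ler_pdivrMr // mul1r lerDl ltW.
  rewrite dotDl !dotZl mulrAC [s' / _ * _]mulrAC -mulrDl ler_pdivrMr // => H.
  rewrite ler_pdivrMr // mulrAC ler_pdivlMr //; nra.
have [e e0 Ke] := K_absorbing v.
have [e' e'0 Ke'] := K_absorbing (- v).
have L0 : L !=set0.
  exists (- e'^-1); exists 0, e'; split=> //; first exact: sub0mx.
    by rewrite sub0r -scalerN.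
  by rewrite dot0l sub0r mulN1r.
have Lb : has_ubound L.
  exists e^-1 => r Lr; have := LU r 0 e Lr.
  by rewrite dot0l subr0 mul1r add0r sub0mx; apply.
exists (b + (sup L - dot v b) *: c).
have dE y : dot y (b + (sup L - dot v b) *: c) =
    dot y b + (sup L - dot v b) * dot y c.
  by rewrite ![dot y _]dotC dotDl dotZl.
split; first by move=> y yU; rewrite dE cU // mulr0 addr0.
move=> y Ky /sub_addsmxP[[u1 u2] /= yE].
have {yE} yE : y = u1 *m U + u2 0 0 *: v.
  by rewrite yE; congr (_ + _); rewrite [u2]mx11_scalar mul_scalar_mx mxE eqxx.
move: yE Ky; set z := u1 *m U; set s := u2 0 0 => yE Ky.
have zU : (z <= U)%MS by apply: submxMl.
rewrite dE yE !dotDl !dotZl cU // cv add0r mulr1.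
suff : s * sup L <= 1 - dot z b by nra.
case: (ltrgtP s 0) => s0.
- have : L ((dot z b - 1) / - s).
    by exists z, (- s); split; rewrite ?oppr_gt0 // scaleNr opprK -yE.
  move/(ub_le_sup Lb); rewrite ler_pdivrMr ?oppr_gt0 //; nra.
- have : sup L <= (1 - dot z b) / s.
    by apply: ge_sup => // r Lr; apply: LU => //; rewrite -yE.
  by rewrite ler_pdivlMr // mulrC.
- rewrite s0 mul0r subr_ge0; apply: bU => //.
  by rewrite (_ : z = y) // yE s0 scale0r addr0.
Qed.

(** The row space of [U] is enlarged one direction at a time; a functional on
    it is represented by any vector [b] inducing it. *)
Lemma hahn_banach m (U : 'M[R]_(m, d)) (b : 'rV[R]_d) :
  (forall y, K y -> (y <= U)%MS -> dot y b <= 1) ->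
  exists b', (forall y, (y <= U)%MS -> dot y b' = dot y b) /\
    forall y, K y -> dot y b' <= 1.
Proof.
have [k] := ubnP (d - \rank U)%N; elim: k m U b => // k IH m U b dU bU.
case: (boolP (row_full U)) => [fU|].
  by exists b; split=> // y Ky; apply: bU => //; apply: submx_full.
rewrite -sub1mx => /row_subPn[i iU].
have [b1 [b1U b1K]] := hahn_banach_step iU bU.
have [|b2 [b2U b2K]] := IH _ (U + row i 1%:M)%MS b1 _ b1K.
  apply: leq_trans (_ : (d - \rank U)%N <= k)%N; last by rewrite -ltnS.
  apply: ltn_sub2l.
    rewrite ltn_neqAle rank_leq_col andbT; apply/negP => rU.
    by move/negP: iU; apply; apply: submx_full.
  apply: rank_ltmx; rewrite ltmxE addsmxSl /=.
  by apply: contra iU; apply: submx_trans (addsmxSr _ _).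
exists b2; split=> // y yU; rewrite b2U ?b1U //.
exact: submx_trans yU (addsmxSl _ _).
Qed.

End HahnBanach.

(** * Convex bodies and their supporting functionals *)

Section Functionals.
Variables (R : realType) (d : nat).

Definition functional (a : 'rV[R]_d) : 'Hom('rV[R]_d, R^o) :=
  linfun (pairing a).

Lemma functionalE a x : functional a x = dot x a.
Proof. by rewrite lfunE. Qed.

Lemma functional_ex (f : 'Hom('rV[R]_d, R^o)) : exists a, f = functional a.
Proof.
exists (\row_i f (delta_mx 0 i)); apply/lfunP => x.
rewrite functionalE dotE {1}[x]row_sum_delta linear_sum /=.
by apply: eq_bigr => i _; rewrite linearZ /= mxE.
Qed.

Lemma functional_eq0 a : (functional a == 0) = (a == 0).
Proof.
apply/eqP/eqP => [a0|->]; last by apply/lfunP => x; rewrite functionalE dotC dot0l lfunE.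
by apply: dot_inj => x; rewrite -functionalE a0 lfunE dotC dot0l.
Qed.

Lemma functional_inj : injective functional.
Proof. by move=> a b ab; apply: dot_inj => x; rewrite -!functionalE ab. Qed.

Lemma functional_is_linear : linear functional.
Proof.
move=> k a b; apply/lfunP => x; rewrite functionalE !lfunE /= lfunE /= !functionalE.
by rewrite !(dotC x) dotDl dotZl.
Qed.
HB.instance Definition _ :=
  GRing.isLinear.Build R 'rV[R]_d 'Hom('rV[R]_d, R^o) _ functional functional_is_linear.

Lemma conv_hull_functional n (a : 'I_n -> 'rV[R]_d) :
  conv_hull (functional \o a) 0 <-> conv_hull a 0.
Proof.
have sumE (w : 'I_n -> R) : \sum_i w i *: (functional \o a) i =
    functional (\sum_i w i *: a i).
  by rewrite linear_sum; apply: eq_bigr => i _; rewrite linearZ.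
split=> -[w [w0 w1 wE]]; exists w; split=> //.
  by apply: functional_inj; rewrite linear0 -sumE.
by rewrite sumE -wE linear0.
Qed.

End Functionals.

Arguments functional {R d}.

Section Topology.
Variables (R : realType).

Lemma interiorP d (A : set 'rV[R]_d) x :
  interior A x <-> exists2 r, 0 < r & forall y, `|y| < r -> A (x + y).
Proof.
rewrite /interior; split=> [/nbhs_ballP[r r0 rA]|[r r0 rA]].
  exists r => // y yr; apply: rA; rewrite -ball_normE /=.
  by rewrite opprD addNKr normrN.
apply/nbhs_ballP; exists r => // y; rewrite -ball_normE /= => xy.
by rewrite -(subrK x y) addrC; apply: rA; rewrite distrC.
Qed.

Lemma interior_translate d (A : set 'rV[R]_d) t x :
  interior (translate t A) x <-> interior A (x - t).
Proof.
rewrite !interiorP; split=> -[r r0 rA]; exists r => // y /rA.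
  by move=> [z Az zE]; rewrite addrAC -zE addrC addKr.
by move=> Az; exists (x - t + y) => //; rewrite addrCA addrA subrK.
Qed.

Lemma mulmx_continuous m n (B : 'M[R]_(m, n)) :
  continuous (fun x : 'rV[R]_m => x *m B).
Proof.
have -> : (fun x : 'rV[R]_m => x *m B) =
    (fun x => \sum_i x 0 i *: row i B).
  by apply/funext => x; rewrite mulmx_sum_row.
apply: continuous_big; first exact: add_continuous.
move=> i _ x; apply: (@cvgZr_tmp _ _ _ (nbhs x)); exact: coord_continuous.
Qed.

End Topology.

Section ConvexBody.
Variables (R : realType) (d : nat) (K : set 'rV[R]_d).
Hypotheses (bodyK : convex_body K) (symK : o_symmetric K).

Lemma body_convex x y s : 0 <= s <= 1 -> K x -> K y ->
  K (s *: x + (1 - s) *: y).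
Proof.
case: bodyK => _ cK _ /andP[s0 s1] Kx Ky.
have := cK x y (Itv01 s0 s1); rewrite !inE => /(_ Kx Ky).
by [].
Qed.

Lemma body_opp x : K x -> K (- x).
Proof. by move=> Kx; rewrite symK; exists x. Qed.

(** By symmetry the reflection of a ball inside [K] lies in [K] too, and the
    average of the two is centred at the origin. *)
Lemma body_ball : exists2 r, 0 < r & forall y, `|y| < r -> K y.
Proof.
case: bodyK => _ _ [x /interiorP[r r0 rK]]; exists r => // y yr.
have -> : y = 2^-1 *: (x + y) + (1 - 2^-1) *: (- (x + - y)).
  have -> : 1 - 2^-1 = 2^-1 :> R by field.
  rewrite -scalerDr opprD opprK addrACA subrr add0r scalerDr -scalerDl.
  by rewrite [X in X *: _](_ : _ = 1) ?scale1r //; field.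
apply: body_convex; last by apply/body_opp/rK; rewrite normrN.
  by apply/andP; split; lra.
exact: rK.
Qed.

Lemma body_absorbing y : exists2 e, 0 < e & K (e *: y).
Proof.
have [r r0 rK] := body_ball.
have y1 : 0 < `|y| + 1 by rewrite ltr_wpDl.
exists (r / (`|y| + 1)); first by rewrite divr_gt0.
apply: rK; rewrite normrZ ger0_norm ?divr_ge0 ?ltW //.
by rewrite mulrAC ltr_pdivrMr // ltr_pM2l // ltrDl.
Qed.

Lemma body0 : K 0.
Proof. by have [e _] := body_absorbing 0; rewrite scaler0. Qed.

(** The cone over a ball around the origin with apex [s x] is a neighbourhood
    of [x]; hence interior and boundary points are recognised along rays. *)
Lemma body_interiorP x : interior K x <-> exists2 s, 1 < s & K (s *: x).
Proof.
split=> [/interiorP[r r0 rK]|[s s1 Ks]].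
  have x1 : 0 < `|x| + 1 by rewrite ltr_wpDl.
  exists (1 + r / (`|x| + 1)); first by rewrite ltrDl divr_gt0.
  rewrite scalerDl scale1r; apply: rK.
  rewrite normrZ ger0_norm ?divr_ge0 ?ltW //.
  by rewrite mulrAC ltr_pdivrMr // ltr_pM2l // ltrDl.
have [r r0 rK] := body_ball; apply/interiorP.
have s0 : 0 < s by apply: lt_trans s1.
have t0 : 0 < 1 - s^-1 by rewrite subr_gt0 invf_lt1.
exists ((1 - s^-1) * r); first by rewrite mulr_gt0.
move=> y yr; have -> : x + y = s^-1 *: (s *: x) + (1 - s^-1) *: ((1 - s^-1)^-1 *: y).
  by rewrite !scalerA mulVf ?gt_eqF // divff ?gt_eqF // !scale1r.
apply: body_convex => //; first by rewrite invr_ge0 ltW //= invf_le1 // ltW.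
apply: rK; rewrite normrZ normfV gtr0_norm //.
by rewrite mulrC ltr_pdivrMr // mulrC.
Qed.

Lemma body_boundaryP x :
  boundary K x <-> K x /\ forall s, 1 < s -> ~ K (s *: x).
Proof.
have cK : closure K = K.
  apply/esym/closure_id; apply: compact_closed; first exact: norm_hausdorff.
  by case: bodyK.
rewrite /boundary cK; split=> -[Kx H]; split=> //.
  by move=> s s1 Ks; apply: H; apply/body_interiorP; exists s.
by move/body_interiorP => [s /H].
Qed.

Definition supports (x a : 'rV[R]_d) : Prop :=
  dot x a = 1 /\ forall y, K y -> dot y a <= 1.

Lemma supports_ge a x y : supports x a -> K y -> -1 <= dot y a.
Proof. by move=> [_ H] /body_opp/H; rewrite dotNl; lra. Qed.

Lemma supporting_functionalP x a :
  supporting_functional K x (functional a) <-> supports x a.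
Proof.
split=> [[fx fK]|xa].
  split; first by rewrite -functionalE.
  by move=> y /fK; rewrite functionalE => /andP[].
split; first by rewrite functionalE; case: xa.
move=> y Ky; rewrite functionalE (supports_ge xa) //=.
by case: xa => _; apply.
Qed.

Lemma supports_boundary x a : K x -> supports x a -> boundary K x.
Proof.
move=> Kx [xa aK]; apply/body_boundaryP; split=> // s s1 /aK.
by rewrite dotZl xa; lra.
Qed.

Lemma interior_dot_lt1 x y a : supports x a -> interior K y -> dot y a < 1.
Proof.
move=> [_ aK] /body_interiorP[s s1 /aK]; rewrite dotZl => H; nra.
Qed.

(** Extend the functional equal to one at [x] from the line through [x]. *)
Lemma boundary_supports x : boundary K x -> exists a, supports x a.
Proof.
move/body_boundaryP => [Kx xK].
have x0 : x != 0.
  by apply/eqP => x0; apply: (xK 2); [lra|rewrite x0 scaler0 -x0].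
have xx : 0 < dot x x.
  by rewrite lt_neqAle dot_ge0 andbT eq_sym; apply: contra_neq x0 => /dot_eq0.
have xb : dot x ((dot x x)^-1 *: x) = 1 by rewrite dotZr mulVf ?gt_eqF.
have [|b [bx bK]] := hahn_banach body_convex body_absorbing (m := 1) (U := x)
    (b := (dot x x)^-1 *: x).
  move=> y Ky /sub_rVP[s ys]; rewrite ys dotZl xb mulr1 leNgt; apply/negP => s1.
  by apply: (xK s) => //; rewrite -ys.
by exists b; split=> //; rewrite bx.
Qed.

End ConvexBody.

Section Regular.
Variables (R : realType).

(** Smoothness and strict convexity expressed through supporting functionals:
    these two forms are dual to each other and pass to sections and projections. *)
Definition unique_support d (K : set 'rV[R]_d) :=
  forall x a b, K x -> supports K x a -> supports K x b -> a = b.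
Definition unique_contact d (K : set 'rV[R]_d) :=
  forall x y a, K x -> K y -> supports K x a -> supports K y a -> x = y.

Section Body.
Variables (d : nat) (K : set 'rV[R]_d).
Hypotheses (bodyK : convex_body K) (symK : o_symmetric K).

(** The origin being interior, a supporting hyperplane misses it and can be
    normalised to level one. *)
Lemma supporting_hyperplaneP x H : K x ->
  supporting_hyperplane K x H <->
  exists2 a, supports K x a & H = hyperplane (functional a) 1.
Proof.
move=> Kx; split=> [[f [c [f0 -> fx fK]]]|[a [xa aK] ->]].
  have [a fE] := functional_ex f; subst f.
  rewrite /hyperplane /= functionalE in fx.
  have {}fK y : K y -> dot y a <= c by move=> /fK; rewrite functionalE.
  rewrite functional_eq0 in f0.
  have aa : 0 < dot a a.
    by rewrite lt_neqAle dot_ge0 andbT eq_sym; apply: contra_neq f0 => /dot_eq0.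
  have c0 : 0 < c.
    have [e e0 /fK] := body_absorbing bodyK symK a.
    by rewrite dotZl; apply: lt_le_trans; rewrite mulr_gt0.
  exists (c^-1 *: a).
    split; first by rewrite dotZr fx mulVf ?gt_eqF.
    by move=> y /fK; rewrite dotZr mulrC ler_pdivrMr // mul1r.
  apply/seteqP; split=> y; rewrite /hyperplane /= !functionalE dotZr.
    by move=> ->; rewrite mulVf ?gt_eqF.
  move=> H1; rewrite -[dot y a](mulKf (x := c)) ?gt_eqF //.
  by rewrite mulrCA mulrA -mulrA H1 mulr1.
exists (functional a), 1; split=> //.
- rewrite functional_eq0; apply/eqP => a0; move: xa.
  by rewrite a0 dotC dot0l => /eqP; rewrite eq_sym oner_eq0.
- by rewrite /hyperplane /= functionalE.
- by move=> y /aK; rewrite functionalE.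
Qed.

Lemma hyperplane_inj x a b : supports K x a -> supports K x b ->
  hyperplane (functional a) 1 = hyperplane (functional b) 1 -> a = b.
Proof.
move=> [xa _] [xb _] E; apply: dot_inj => y.
have H z : dot z a = 1 -> dot z b = 1.
  by move=> za; have : hyperplane (functional b) 1 z;
    [rewrite -E|]; rewrite /hyperplane /= functionalE.
have := H (y + (1 - dot y a) *: x).
rewrite !dotDl !dotZl xa xb !mulr1 addrC subrK => /(_ erefl); lra.
Qed.

Lemma smoothP : smooth K <-> unique_support K.
Proof.
split=> [sK x a b Kx xa xb|uK x bx].
  have [H [_ HU]] := sK x (supports_boundary bodyK symK Kx xa).
  apply: (hyperplane_inj xa xb).
  rewrite -(HU (hyperplane (functional a) 1)); last first.
    by apply/supporting_hyperplaneP => //; exists a.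
  by apply: HU; apply/supporting_hyperplaneP => //; exists b.
have Kx : K x by move/(body_boundaryP bodyK symK) : bx => [].
have [a xa] := boundary_supports bodyK symK bx.
exists (hyperplane (functional a) 1); split.
  by apply/supporting_hyperplaneP => //; exists a.
by move=> H /(supporting_hyperplaneP _ Kx) [b xb ->]; rewrite (uK x a b).
Qed.

(** A functional supporting [K] at the midpoint of a boundary segment takes its
    maximum at both ends. *)
Lemma strictly_convexP : strictly_convex K <-> unique_contact K.
Proof.
split=> [sK x y a Kx Ky xa ya|eK x y seg].
  apply: sK => z [s]; rewrite /= in_itv /= => /andP[s0 s1] <-.
  apply: (supports_boundary bodyK symK (a := a)).
    rewrite -[X in _ + X *: _](subKr 1); apply: body_convex => //.
    by apply/andP; split; lra.
  case: xa ya => xa aK [ya _]; split=> //.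
  by rewrite dotDl !dotZl xa ya; lra.
have in_seg s : 0 <= s <= 1 -> boundary K ((1 - s) *: x + s *: y).
  by move=> s01; apply: seg; exists s => //=; rewrite in_itv.
have Kx : K x.
  have := in_seg 0; rewrite subr0 scale1r scale0r addr0 lexx ler01 => /(_ isT).
  by move/(body_boundaryP bodyK symK) => [].
have Ky : K y.
  have := in_seg 1; rewrite subrr scale1r scale0r add0r lexx ler01 => /(_ isT).
  by move/(body_boundaryP bodyK symK) => [].
have /(boundary_supports bodyK symK)[a [ma aK]] : boundary K ((1 - 2^-1) *: x + 2^-1 *: y).
  by apply: in_seg; apply/andP; split; lra.
move: ma; rewrite dotDl !dotZl => ma.
have xa := aK _ Kx; have ya := aK _ Ky.
by apply: (eK x y a) => //; split=> //; lra.
Qed.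

End Body.

Lemma regular_bodyP d (K : set 'rV[R]_d) : regular_body K <->
  [/\ convex_body K, o_symmetric K, unique_support K & unique_contact K].
Proof.
split=> -[bK sK].
  by move=> /(smoothP bK sK) ? /(strictly_convexP bK sK).
by move=> /(smoothP bK sK) ? /(strictly_convexP bK sK).
Qed.

End Regular.

(** * Sections, projections and separable systems *)

Section Slices.
Variables (R : realType).

Lemma convex_bodyI d (K : set 'rV[R]_d) : compact K ->
  (forall x y s, 0 <= s <= 1 -> K x -> K y -> K (s *: x + (1 - s) *: y)) ->
  interior K 0 -> convex_body K.
Proof.
move=> cK vK iK; split=> //; last by exists 0.
move=> x y l; rewrite !inE => Kx Ky; apply: (vK x y l%:num) => //.
by rewrite ge0 le1.
Qed.

Lemma o_symmetricI d (K : set 'rV[R]_d) :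
  (forall x, K x -> K (- x)) -> o_symmetric K.
Proof.
move=> sK; apply/seteqP; split=> x; last by move=> [y /sK ? <-].
by move=> /sK Kx; exists (- x); rewrite ?opprK.
Qed.

Variables (r d : nat) (K : set 'rV[R]_d) (B : 'M[R]_(r, d)).
Hypotheses (regK : regular_body K) (freeB : row_free B).

Let bodyK : convex_body K. Proof. by case: regK. Qed.
Let symK : o_symmetric K. Proof. by case: regK. Qed.

Let BBi : B *m pinvmx B = 1%:M.
Proof. exact: mulmxVp. Qed.

Let interior0 : interior K 0.
Proof.
apply/interiorP; have [e e0 eK] := body_ball bodyK symK.
by exists e => // y; rewrite add0r; apply: eK.
Qed.

Definition section_body : set 'rV[R]_r := [set y | K (y *m B)].

Definition projection_body : set 'rV[R]_r := [set x *m B^T | x in K].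

(** A supporting functional of the section extends to one of [K] at the same
    point, so both uniqueness properties are inherited from [K]. *)
Lemma section_body_regular : regular_body section_body.
Proof.
have [_ _ uK eK] := (regular_bodyP K).1 regK.
have bS : convex_body section_body.
  apply: convex_bodyI.
  - have -> : section_body =
        [set x *m pinvmx B | x in K `&` [set x | x *m (pinvmx B *m B - 1%:M) = 0]].
      apply/seteqP; split=> [y Ky|_ [x [Kx /= xB] <-]].
        exists (y *m B); last by rewrite -mulmxA BBi mulmx1.
        by split=> //=; rewrite mulmxBr mulmx1 -mulmxA (mulmxA B) BBi mul1mx subrr.
      rewrite /section_body /= -mulmxA; move: xB; rewrite mulmxBr mulmx1.
      by move/subr0_eq ->.
    apply: continuous_compact; first exact/continuous_subspaceT/mulmx_continuous.
    apply: compact_closedI; first by case: bodyK.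
    have /continuous_closedP cl := mulmx_continuous (B := pinvmx B *m B - 1%:M).
    apply: (cl [set 0]); apply: accessible_closed_set1.
    by apply: hausdorff_accessible; apply: norm_hausdorff.
  - move=> x y s s01 Kx Ky; rewrite /section_body /= mulmxDl -!scalemxAl.
    exact: body_convex.
  - rewrite /interior; apply: (mulmx_continuous (B := B) (x := 0)).
    by rewrite mul0mx; exact: interior0.
have sS : o_symmetric section_body.
  by apply: o_symmetricI => x Kx; rewrite /section_body /= mulNmx; apply: body_opp.
have extend y a : section_body y -> supports section_body y a ->
    exists2 b, supports K (y *m B) b & b *m B^T = a.
  move=> Ky [ya aS].
  have aE z : dot (z *m B) (a *m (pinvmx B)^T) = dot z a.
    by rewrite dot_mulmx -mulmxA -trmx_mul BBi trmx1 mulmx1.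
  have [|b [bB bK]] := hahn_banach (body_convex bodyK)
      (body_absorbing bodyK symK) (U := B) (b := a *m (pinvmx B)^T).
    by move=> x Kx /submxP[z xE]; rewrite xE aE; apply: aS; rewrite /section_body /= -xE.
  exists b; first by split=> //; rewrite bB ?submxMl // aE.
  by apply: dot_inj => z; rewrite -dot_mulmx bB ?submxMl // aE.
apply/regular_bodyP; split=> //.
  move=> y a1 a2 Ky /(extend _ _ Ky)[b1 yb1 <-] /(extend _ _ Ky)[b2 yb2 <-].
  by rewrite (uK (y *m B) b1 b2).
move=> x y a Kx Ky xa ya.
have [b xb bE] := extend _ _ Kx xa.
apply: (row_free_inj freeB); apply: (eK _ _ b) => //; split; last by case: xb.
by rewrite dot_mulmx bE; case: ya.
Qed.

(** Composing with the projection turns supporting functionals of the image into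
    supporting functionals of [K]. *)
Lemma projection_body_regular : regular_body projection_body.
Proof.
have [_ _ uK eK] := (regular_bodyP K).1 regK.
have bS : convex_body projection_body.
  apply: convex_bodyI.
  - apply: continuous_compact; first exact/continuous_subspaceT/mulmx_continuous.
    by case: bodyK.
  - move=> _ _ s s01 [x Kx <-] [y Ky <-].
    exists (s *: x + (1 - s) *: y); first exact: body_convex.
    by rewrite mulmxDl -!scalemxAl.
  - have sub : [set y | K (y *m (pinvmx B)^T)] `<=` projection_body.
      move=> y Ky; exists (y *m (pinvmx B)^T) => //.
      by rewrite -mulmxA -trmx_mul BBi trmx1 mulmx1.
    rewrite /interior; apply: (filterS sub).
    apply: (mulmx_continuous (B := (pinvmx B)^T) (x := 0)).
    by rewrite mul0mx; exact: interior0.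
have sS : o_symmetric projection_body.
  apply: o_symmetricI => _ [x Kx <-]; exists (- x); first exact: body_opp.
  by rewrite mulNmx.
have lift x a : supports projection_body (x *m B^T) a -> supports K x (a *m B).
  rewrite /supports dot_mulmx trmxK => -[xa aS]; split=> // y Ky.
  by rewrite -[B]trmxK -dot_mulmx; apply: aS; exists y.
apply/regular_bodyP; split=> //.
  move=> _ a1 a2 [x Kx <-] /lift xa1 /lift xa2.
  by apply: (row_free_inj freeB); apply: (uK x).
move=> _ _ a [x Kx <-] [y Ky <-] /lift xa /lift ya.
by rewrite (eK x y (a *m B)).
Qed.

End Slices.

Section Systems.
Variables (R : realType).

(** The algebraic form of a separable Hadwiger configuration: a system stands for
    the translates [2 x_i + K], and the last condition says that the hyperplane
    [a_j = 1], which separates [K] from [2 x_j + K], does not cut [2 x_i + K]. *)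
Definition sep_system d (K : set 'rV[R]_d) n (x a : 'I_n -> 'rV[R]_d) : Prop :=
  [/\ forall i, K (x i), forall i, supports K (x i) (a i) &
      forall i j, i != j -> dot (x i) (a j) <= 0].

Lemma sep_system_section r d (K : set 'rV[R]_d) (B : 'M[R]_(r, d)) n
    (y : 'I_n -> 'rV[R]_r) (a : 'I_n -> 'rV[R]_d) :
  sep_system K (fun i => y i *m B) a ->
  sep_system (section_body K B) y (fun i => a i *m B^T).
Proof.
move=> [Kx xa off]; split=> //.
  move=> i; have [ia aK] := xa i; split; first by rewrite -dot_mulmx.
  by move=> z /aK; rewrite dot_mulmx.
by move=> i j ij; rewrite -dot_mulmx off.
Qed.

Lemma sep_system_projection r d (K : set 'rV[R]_d) (B : 'M[R]_(r, d)) n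
    (x : 'I_n -> 'rV[R]_d) (b : 'I_n -> 'rV[R]_r) :
  sep_system K x (fun i => b i *m B) ->
  sep_system (projection_body K B) (fun i => x i *m B^T) b.
Proof.
move=> [Kx xa off]; split.
- by move=> i; exists (x i).
- move=> i; have [ia aK] := xa i; split; first by rewrite dot_mulmx trmxK.
  by move=> _ [z /aK + <-]; rewrite dot_mulmx trmxK.
- by move=> i j ij; rewrite dot_mulmx trmxK off.
Qed.

Lemma sep_system_reindex d (K : set 'rV[R]_d) m n (g : 'I_m -> 'I_n) x a :
  injective g -> sep_system K x a -> sep_system K (x \o g) (a \o g).
Proof.
move=> ginj [Kx xa off]; split=> [i|i|i j ij] /=; [exact: Kx|exact: xa|].
by apply: off; rewrite (inj_eq ginj).
Qed.

Variables (d : nat) (K : set 'rV[R]_d).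
Hypothesis (regK : regular_body K).

Let bodyK : convex_body K. Proof. by case: regK. Qed.
Let symK : o_symmetric K. Proof. by case: regK. Qed.

(** The hyperplane [a_i = 1] leaves [2 x_i + K] on one side and [K] with all the
    other translates on the other. *)
Lemma sep_system_config n (x a : 'I_n -> 'rV[R]_d) : sep_system K x a ->
  sep_hadwiger_config K (fun i => 2 *: x i).
Proof.
move=> [Kx xa off].
have above i y : translate (2 *: x i) K y -> 1 <= dot y (a i).
  move=> [z Kz <-]; rewrite dotDl dotZl; have := supports_ge symK (xa i) Kz.
  by case: (xa i) => -> _; lra.
have above_int i y : interior (translate (2 *: x i) K) y -> 1 < dot y (a i).
  move/interior_translate => yi.
  have /(supports_ge symK (xa i)) : K (- (y - 2 *: x i)).
    by apply: body_opp symK _ _; apply: interior_subset yi.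
  have := interior_dot_lt1 bodyK symK (xa i).
  move=> /(_ (- (y - 2 *: x i))).
  rewrite dotNl dotDl dotNl dotZl; case: (xa i) => -> _ H _.
  have : interior K (- (y - 2 *: x i)).
    move: yi => /(body_interiorP bodyK symK)[s s1 Ks]; apply/(body_interiorP bodyK symK).
    by exists s => //; rewrite scalerN; apply: body_opp.
  by move/H; lra.
have below i o y : o <> Some i ->
    translate (with_origin (fun i => 2 *: x i) o) K y -> dot y (a i) <= 1.
  move=> oi [z Kz <-]; rewrite dotDl; have [_ /(_ _ Kz)] := xa i.
  case: o oi => [j|_] /=; last by rewrite dot0l; lra.
  move=> ji; rewrite dotZl; have : dot (x j) (a i) <= 0.
    by apply: off; apply/eqP => jE; apply: ji; rewrite jE.
  lra.
have below_int i o y : o <> Some i ->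
    interior (translate (with_origin (fun i => 2 *: x i) o) K) y -> dot y (a i) < 1.
  move=> oi /interior_translate; set t := with_origin _ o.
  move/(interior_dot_lt1 bodyK symK (xa i)); rewrite dotDl dotNl.
  suff : dot t (a i) <= 0 by lra.
  have := @below i o t oi; rewrite /t; case: (o) oi => [j|_] /=; last by rewrite dot0l lexx.
  move=> ji _; rewrite dotZl; have : dot (x j) (a i) <= 0.
    by apply: off; apply/eqP => jE; apply: ji; rewrite jE.
  lra.
split.
  move=> i; exists (x i); split; last exact: Kx.
  exists (- x i); first exact: body_opp.
  by rewrite scaler_nat mulr2n addrK.
split.
  move=> o o' oo'; apply/seteqP; split=> // y [yo yo'].
  case: o oo' yo => [i|] oo' yo.
    by have := above_int i y yo; have := @below_int i o' y (nesym oo') yo'; lra.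
  case: o' oo' yo' => [i|] // oo' yo'.
  by have := above_int i y yo'; have := @below_int i None y oo' yo; lra.
have miss i k c : c = 1 \/ c = -1 ->
    hyperplane (functional (c *: a i)) c `&`
    interior (translate (with_origin (fun i => 2 *: x i) k) K) = set0.
  move=> c1; apply/seteqP; split=> // y [].
  rewrite /hyperplane /= functionalE dotZr => yc yk.
  have y1 : dot y (a i) = 1 by case: c1 yc => ->; lra.
  case: (pselect (k = Some i)) => [kE|ki].
    by rewrite kE in yk; have := above_int i y yk; rewrite y1 ltxx.
  by have := below_int i k y ki yk; rewrite y1 ltxx.
have a0 i c : c = 1 \/ c = -1 -> functional (c *: a i) != 0.
  move=> c1; rewrite functional_eq0; apply/eqP => H; have [xai _] := xa i.
  have := dotZr c (x i) (a i); rewrite H dotC dot0l xai.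
  by case: c1 => ->; lra.
move=> o o' oo'; case: o' oo' => [i|] oo'.
  exists (functional (1 *: a i)), 1; split.
  - by apply: a0; left.
  - by move=> y /(@below i o y oo'); rewrite functionalE dotZr mul1r.
  - by move=> y /(above i y); rewrite functionalE dotZr mul1r.
  - by move=> k; apply: miss; left.
case: o oo' => [i|] // oo'.
exists (functional (-1 *: a i)), (-1); split.
- by apply: a0; right.
- by move=> y /(above i y); rewrite functionalE dotZr; lra.
- by move=> y /(@below i None y (nesym oo')); rewrite functionalE dotZr; lra.
- by move=> k; apply: miss; right.
Qed.

(** A hyperplane separating [K] from [2 x_i + K] passes through their common
    point [x_i], so up to scale it is [a_i = 1] with [a_i] supporting. On
    [2 x_j + K] the functional [a_i] has centre value [2 a_i(x_j)] and ranges over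
    an interval of half-length one, so avoiding the value one in the interior
    excludes [0 < a_i(x_j) < 1]. If [a_i(x_j)] were one, strict convexity would
    give [x_i = x_j], and two members of the packing would coincide. *)
Lemma config_sep_system n (t : 'I_n -> 'rV[R]_d) : sep_hadwiger_config K t ->
  exists x a, sep_system K x a /\ t = (fun i => 2 *: x i).
Proof.
have [_ _ _ eK] := (regular_bodyP K).1 regK.
move=> [tch [pack sepK]].
pose x i := 2^-1 *: t i.
have tE i : t i = 2 *: x i by rewrite scalerA divff ?scale1r // pnatr_eq0.
have Kx i : K (x i).
  have [b [[c Kc cE] Kb]] := tch i.
  have -> : x i = 2^-1 *: b + (1 - 2^-1) *: (- c).
    rewrite (_ : 1 - 2^-1 = 2^-1 :> R); last by field.
    by rewrite -scalerDr -cE addrK.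
  apply: body_convex => //; last exact: body_opp.
  by apply/andP; split; lra.
have exa i : exists a, supports K (x i) a /\
    forall j, interior (translate (t j) K) `<=` [set y | dot y a != 1].
  have [|f [c [f0 below above miss]]] := sepK None (Some i); first by [].
  have xc : f (x i) = c.
    apply/eqP; rewrite eq_le; apply/andP; split.
      by apply: below; exists (x i) => //; rewrite add0r.
    apply: above; exists (- x i); first exact: body_opp.
    by rewrite /= tE scaler_nat mulr2n addrK.
  have fK y : K y -> f y <= c by move=> Ky; apply: below; exists y => //; rewrite add0r.
  have : supporting_hyperplane K (x i) (hyperplane f c) by exists f, c.
  move/(supporting_hyperplaneP bodyK symK _ (Kx i)) => [a xa fa].
  exists a; split=> // j y yj; apply/eqP => ya.
  suff : set0 y by [].
  by rewrite -(miss (Some j)); split=> //; rewrite fa /hyperplane /= functionalE.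
have [a aP] := choice exa.
exists x, a; split; last by apply/funext.
split=> //; first by move=> i; case: (aP i).
move=> j i ji; have [xai miss] := aP i; have [xi1 aK] := xai.
rewrite leNgt; apply/negP => pos.
have := aK _ (Kx j); rewrite le_eqVlt => /orP[/eqP xj1|lt1].
  have xji : x j = x i by apply: (eK _ _ (a i)) => //; split.
  have [e e0 eK'] := body_ball bodyK symK.
  have int0 : interior (translate (t i) K) (t i).
    apply/interior_translate; rewrite subrr; apply/interiorP.
    by exists e => // y; rewrite add0r; apply: eK'.
  suff : set0 (t i) by [].
  have ne : Some j <> Some i by move=> [jE]; rewrite jE eqxx in ji.
  by rewrite -(pack _ _ ne) /=; split=> //=; rewrite tE xji -tE.
(* With this [s] the point [t j + s x_i] lies on the hyperplane. *)
pose s := 1 - 2 * dot (x j) (a i).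
have : interior (translate (t j) K) (t j + s *: x i).
  apply/interior_translate; rewrite addrAC subrr add0r.
  have [s0|s0] := eqVneq s 0.
    apply/(body_interiorP bodyK symK); exists 2; first lra.
    by rewrite s0 scale0r scaler0; exact: body0.
  have sp : 0 < `|s| by rewrite normr_gt0.
  have s1 : `|s| < 1 by rewrite ltr_norml /s; apply/andP; split; lra.
  apply/(body_interiorP bodyK symK); exists (`|s|^-1); first by rewrite invf_gt1.
  rewrite scalerA; have [sg|sg] := ltP 0 s.
    by rewrite gtr0_norm // mulVf // scale1r.
  by rewrite ler0_norm // invrN mulNr mulVf // scaleN1r; apply: body_opp.
move/miss => /eqP; apply; rewrite dotDl dotZl tE dotZl xi1 /s; ring.
Qed.

Lemma one_sided_sep_system n (x : 'I_n -> 'rV[R]_d) : one_sided_config K x <->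
  exists a, [/\ sep_system K x a, ~ conv_hull x 0 & ~ conv_hull a 0].
Proof.
have [_ _ uK _] := (regular_bodyP K).1 regK.
split=> [[cfg nx nf]|[a [sys nx na]]].
  have [x' [a [sys xE]]] := config_sep_system cfg.
  have {xE}xE : x' = x.
    apply/funext => i; apply: (scalerI (_ : 2 != 0 :> R)); rewrite ?pnatr_eq0 //.
    by rewrite -[LHS](congr1 (@^~ i) xE).
  subst x'; exists a; split=> // /conv_hull_functional; apply: nf.
    by move=> i; apply/(supporting_functionalP symK); case: sys.
split=> //; first exact: sep_system_config sys.
move=> f xf /=; suff -> : f = functional \o a by move/conv_hull_functional.
apply/funext => i /=; have [b fE] := functional_ex (f i).
rewrite fE; congr functional; have [Kx xa _] := sys.
by apply: (uK (x i)) => //; apply/(supporting_functionalP symK); rewrite -fE.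
Qed.

End Systems.

(** * The Euclidean ball and positive parts of linear relations *)

Section Ball.
Variables (R : realType) (d : nat).
Local Notation ball := (unit_ball R d).

Lemma unit_ballE x : ball x <-> dot x x <= 1.
Proof.
rewrite /unit_ball /enorm /= (_ : \sum_i _ = dot x x); last first.
  by rewrite dotE; apply: eq_bigr => i _; rewrite expr2.
by rewrite -{1}[1]sqrtr1 ler_sqrt.
Qed.

Lemma dot_distance (x y : 'rV[R]_d) : 0 <= dot x x - 2 * dot x y + dot y y.
Proof.
have := dot_ge0 (x - y); rewrite dotDl dotNl ![dot _ (x - y)]dotC !dotDl !dotNl.
by rewrite (dotC y x); lra.
Qed.

(** Such an [a] has norm at most one, so the squared distance from [a] to [x] is
    at most [1 - 2 + 1 = 0]. *)
Lemma ball_supports x a : ball x -> supports ball x a -> a = x.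
Proof.
move=> /unit_ballE bx [xa aB].
have aa : 0 < dot a a.
  rewrite lt_neqAle dot_ge0 andbT; apply/eqP => /esym/dot_eq0 a0.
  by move: xa; rewrite a0 dotC dot0l => /eqP; rewrite eq_sym oner_eq0.
have a1 : dot a a <= 1.
  pose s := Num.sqrt (dot a a).
  have s0 : 0 < s by rewrite sqrtr_gt0.
  have ss : s * s = dot a a by rewrite -expr2 sqr_sqrtr // ltW.
  have := aB (s^-1 *: a); rewrite dotZl -ss mulKf ?gt_eqF // => H.
  have : s <= 1.
    apply: H; apply/unit_ballE; rewrite dotZl dotZr -ss.
    by rewrite mulKf ?gt_eqF // mulVf ?gt_eqF.
  by move=> s1; nra.
apply/eqP; rewrite -subr_eq0; apply/eqP/dot_eq0/eqP.
rewrite eq_le dot_ge0 andbT dotDl dotNl ![dot _ (a - x)]dotC !dotDl !dotNl.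
rewrite (dotC a x) xa; lra.
Qed.

Lemma unit_ball_regular : regular_body ball.
Proof.
have bB : convex_body ball.
  apply: convex_bodyI.
  - apply: bounded_closed_compact.
      exists 1; split=> // M M1 x /unit_ballE bx.
      rewrite /Num.norm /= mx_normrE; apply: bigmax_le; first lra.
      move=> [i j] _ /=; rewrite (ord1 i).
      have : x 0 j * x 0 j <= 1.
        apply: le_trans bx; rewrite dotE (bigD1 j) //= lerDl sumr_ge0 // => k _.
        by rewrite -expr2 sqr_ge0.
      move=> xj; apply: le_trans (ltW M1); rewrite ler_norml; apply/andP; split; nra.
    have -> : ball = (fun x => dot x x) @^-1` [set r | r <= 1].
      by apply/seteqP; split=> x /unit_ballE.
    have /continuous_closedP cl : continuous (fun x : 'rV[R]_d => dot x x).
      have -> : (fun x : 'rV[R]_d => dot x x) = (fun x => \sum_i x 0 i * x 0 i).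
        by apply/funext => x; rewrite dotE.
      apply: continuous_big; first exact: add_continuous.
      by move=> i _ x; apply: (@cvgM _ _ (nbhs x)); exact: coord_continuous.
    by apply: cl; exact: closed_le.
  - move=> x y s /andP[s0 s1] /unit_ballE bx /unit_ballE bY; apply/unit_ballE.
    have := dot_distance x y.
    rewrite dotDl !dotZl ![dot _ (_ + _)]dotC !dotDl !dotZl (dotC y x) => H.
    have xy1 : dot x y <= 1 by lra.
    have avg p q : p <= 1 -> q <= 1 -> s * p + (1 - s) * q <= 1.
      by move=> p1 q1; nra.
    have := avg _ _ (avg _ _ bx xy1) (avg _ _ xy1 bY); lra.
  - apply/interiorP; exists (d.+1%:R^-1); first by rewrite invr_gt0 ltr0n.
    move=> y yr; rewrite add0r; apply/unit_ballE; rewrite dotE.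
    have yi i : y 0 i * y 0 i <= d.+1%:R^-1.
      have : `|y 0 i| <= `|y|.
        by rewrite [leRHS]/Num.norm /= mx_normrE; apply: (le_bigmax _ _ (0, i)).
      have -> : y 0 i * y 0 i = `|y 0 i| * `|y 0 i|.
        by rewrite -normrM ger0_norm // -expr2 sqr_ge0.
      move=> yi.
      have d1 : d.+1%:R^-1 <= 1 :> R by rewrite invf_le1 ?ltr0n // ler1n.
      have := normr_ge0 (y 0 i); move: yr yi d1; set e := d.+1%:R^-1; nra.
    apply: le_trans (_ : \sum_(i < d) (d.+1%:R^-1 : R) <= 1); first exact: ler_sum.
    rewrite sumr_const card_ord -[X in X <= _]mulr_natr mulrC ler_pdivrMr ?ltr0n //.
    by rewrite mul1r ler_nat.
have sB : o_symmetric ball.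
  by apply: o_symmetricI => x /unit_ballE bx; apply/unit_ballE; rewrite dotNl dotC dotNl opprK.
apply/regular_bodyP; split=> //.
  by move=> x a b bx /(ball_supports bx) -> /(ball_supports bx) ->.
by move=> x y a bx bY /(ball_supports bx) <- /(ball_supports bY) <-.
Qed.

End Ball.

Section SignedRelation.
Variables (R : realType) (d n : nat) (x a : 'I_n -> 'rV[R]_d).
Hypothesis off : forall i j, i != j -> dot (x i) (a j) <= 0.
Variable mu : 'I_n -> R.
Hypothesis muv : \sum_i mu i *: x i = 0.

Let u := \sum_(i | 0 < mu i) mu i *: x i.

(** The vector [u] is at once the positive part of the relation and the opposite
    of its negative part; use whichever of the two does not involve [x k]. *)
Lemma positive_part_dot_le0 k : dot u (a k) <= 0.
Proof.
have uE : u = \sum_(i | ~~ (0 < mu i)) (- mu i) *: x i.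
  apply/eqP; rewrite -subr_eq0 -sumrN; apply/eqP; apply: etrans muv.
  rewrite [RHS](bigID (fun i => 0 < mu i)) /=; congr (_ + _).
  by apply: eq_bigr => i _; rewrite scaleNr opprK.
case: (boolP (0 < mu k)) => muk.
  rewrite uE dot_suml sumr_le0 // => i mui; rewrite dotZl.
  rewrite mulr_ge0_le0 ?oppr_ge0 -?leNgt //; first by rewrite leNgt.
  by apply: off; apply: contraNneq mui => ->.
rewrite dot_suml sumr_le0 // => i mui; rewrite dotZl mulr_ge0_le0 ?(ltW mui) //.
by apply: off; apply: contraNneq muk => <-.
Qed.

Lemma positive_part0 k : u = 0 -> 0 < mu k -> conv_hull x 0.
Proof.
move=> u0 muk; apply: (@conv_hull0 _ _ _ _ (fun i => Num.max 0 (mu i)) k).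
- by move=> i; rewrite le_max lexx.
- by rewrite lt_max muk orbT.
- apply: etrans u0; rewrite /u [RHS]big_mkcond /=; apply: eq_bigr => i _.
  by rewrite maxElt; case: ifP => _ //; rewrite scale0r.
Qed.

End SignedRelation.

Section OneSidedBounds.
Variables (R : realType) (d n : nat).

Lemma relation_sign (x : 'I_n -> 'rV[R]_d) (mu : 'I_n -> R) k :
  mu k != 0 -> \sum_i mu i *: x i = 0 ->
  exists mu', (exists k, 0 < mu' k) /\ \sum_i mu' i *: x i = 0.
Proof.
move=> muk muv; case: (ltrgtP 0 (mu k)) => [muk0|muk0|muk0].
- by exists mu; split=> //; exists k.
- exists (fun i => - mu i); split; first by exists k; rewrite oppr_gt0.
  by under eq_bigr do rewrite scaleNr; rewrite sumrN muv oppr0.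
- by rewrite -muk0 eqxx in muk.
Qed.

(** For vectors at pairwise non-acute angles the positive part [u] of a relation
    satisfies [dot u u <= 0], hence vanishes. *)
Lemma obtuse_size_le (x : 'I_n -> 'rV[R]_d) :
  (forall i j, i != j -> dot (x i) (x j) <= 0) -> ~ conv_hull x 0 -> (n <= d)%N.
Proof.
move=> off nx; rewrite leqNgt; apply/negP => dn.
have [mu0 [[k0 muk0] mu0v]] := matrix_dependence x dn.
have [mu [[k muk] muv]] := relation_sign muk0 mu0v.
apply: nx; apply: (positive_part0 (mu := mu) (k := k)) => //.
set u := \sum_(i | _) _; apply: dot_eq0.
apply/eqP; rewrite eq_le dot_ge0 andbT {1}/u.
rewrite dot_suml sumr_le0 // => i mui; rewrite dotZl dotC.
by rewrite mulr_ge0_le0 ?(ltW mui) // positive_part_dot_le0.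
Qed.

End OneSidedBounds.

(** * Upper bounds and maxima *)

Section LowDimension.
Variables (R : realType) (d : nat) (K : set 'rV[R]_d).
Hypothesis regK : regular_body K.

(** Let [k] maximise [mu]. If the positive part is [mu k x_k] alone, it pairs
    positively with [a_k]. If it is [mu k x_k + mu l x_l], then pairing with [a_k]
    and [a_k(x_l) >= -1] force [mu l = mu k] and [a_k(x_l) = -1], so that
    [x_k = - x_l] by strict convexity, putting the origin in the hull. *)
Lemma positive_support_gt2 n (x a : 'I_n -> 'rV[R]_d) (mu : 'I_n -> R) :
  sep_system K x a -> ~ conv_hull x 0 ->
  (exists k, 0 < mu k) -> \sum_i mu i *: x i = 0 ->
  (2 < #|[pred i | (0 < mu i)%R]|)%N.
Proof.
have [bodyK symK _ eK] := (regular_bodyP K).1 regK.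
move=> [Kx xa off] nx [k0 muk0] muv.
case: (@arg_maxP _ _ _ k0 predT mu isT) => k _ kmax.
have muk : 0 < mu k by apply: lt_le_trans muk0 _; apply: kmax.
rewrite ltnNge; apply/negP => le2.
have := positive_part_dot_le0 off muv k.
rewrite (bigD1 k) //= dotDl dotZl (xa k).1 mulr1 dot_suml.
case: (pselect (exists l, l != k /\ 0 < mu l)) => [[l [lk mul]]|none]; last first.
  rewrite big_pred0; first by rewrite addr0 leNgt muk.
  by move=> i; apply/negP => /andP[mui ik]; apply: none; exists i.
rewrite (bigD1 l) ?mul //= dotZl big_pred0; last first.
  move=> i; apply/negP => /andP[/andP[mui ik] il].
  move: le2; rewrite (cardD1 k) (cardD1 l) (cardD1 i) !inE.
  by rewrite muk mul mui lk ik il !add1n.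
rewrite addr0 => H.
have lower : -1 <= dot (x l) (a k) by apply: (supports_ge symK (xa k)).
have mulk : mu l <= mu k by apply: kmax.
have opp : dot (x l) (a k) = -1 by nra.
have xkl : x k = - x l.
  apply: (eK _ _ (a k)) => //; first exact: body_opp.
  by split; [rewrite dotNl opp opprK | case: (xa k)].
apply: nx; apply: (@conv_hull0 _ _ _ _ (fun i => (i == k)%:R + (i == l)%:R) k).
- by move=> i; rewrite addr_ge0 // ler0n.
- by rewrite eqxx ltr_pwDl // ler0n.
- have pick j : \sum_i (i == j)%:R *: x i = x j.
    rewrite (bigD1 j) //= eqxx scale1r big1 ?addr0 // => i /negbTE ->.
    by rewrite scale0r.
  by under eq_bigr do rewrite scalerDl; rewrite big_split /= !pick xkl addNr.
Qed.

(** A relation between [d + 1] vectors has at least three positive and three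
    negative coefficients, so [d + 1 >= 6]. *)
Lemma sep_system_size_le_dim n (x a : 'I_n -> 'rV[R]_d) : (d <= 4)%N ->
  sep_system K x a -> ~ conv_hull x 0 -> (n <= d)%N.
Proof.
move=> d4 sys nx; rewrite leqNgt; apply/negP => dn.
pose g := widen_ord dn.
have ginj : injective g by move=> i j /(congr1 val) /= ij; apply: val_inj.
have {}sys := sep_system_reindex ginj sys.
have {}nx : ~ conv_hull (x \o g) 0 by move=> /conv_hull_reindex.
have [mu0 [[k0 muk0] mu0v]] := matrix_dependence (x \o g) (ltnSn d).
have [mu [mupos muv]] := relation_sign muk0 mu0v.
have pos_gt2 := positive_support_gt2 sys nx mupos muv.
have neg_gt2 : (2 < #|[pred i | (0 < - mu i)%R]|)%N.
  apply: (positive_support_gt2 sys nx).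
    apply: contrapT => none; apply: nx.
    have [k muk] := mupos; apply: (conv_hull0 (w := mu) (k := k)) => // i.
    by rewrite leNgt; apply/negP => mui; apply: none; exists i; rewrite oppr_gt0.
  by under eq_bigr do rewrite scaleNr; rewrite sumrN muv oppr0.
have : (#|[pred i | (0 < mu i)%R]| + #|[pred i | (0 < - mu i)%R]| <= d.+1)%N.
  rewrite -[X in (_ <= X)%N]card_ord -(cardC [pred i | 0 < mu i]) leq_add2l.
  apply: subset_leq_card; apply/fintype.subsetP => i; rewrite !inE oppr_gt0.
  by move=> mui; rewrite -leNgt ltW.
move/(leq_trans (leq_add pos_gt2 neg_gt2)); lia.
Qed.

End LowDimension.

Section Maxima.

Lemma nat_max_eq (A : set nat) n : is_max A n -> nat_max A = n.
Proof.
move=> [An nA]; apply: xget_unique => // m [Am mA].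
by apply/eqP; rewrite eqn_leq nA // mA.
Qed.

Lemma nat_maxP (A : set nat) N : A !=set0 -> (forall m, A m -> (m <= N)%N) ->
  is_max A (nat_max A).
Proof.
move=> [m0 Am0] AN.
have exA : exists m, `[< A m >] by exists m0; apply/asboolP.
have ubA m : `[< A m >] -> (m <= N)%N by move/asboolP/AN.
case: (ex_maxnP exA ubA) => m /asboolP Am mmax.
suff mP : is_max A m by rewrite (nat_max_eq mP).
by split=> // k Ak; apply: mmax; apply/asboolP.
Qed.

End Maxima.

Section Numbers.
Variable (R : realType).

(** The functional [a_i] separates [x_i] from every other [x_j] by at least one,
    so no two points of a system are close. *)
Lemma sep_system_bounded d : exists N, forall (K : set 'rV[R]_d) n x a,
  regular_body K -> @sep_system R d K n x a -> (n <= N)%N.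
Proof.
have [N HN] := @close_rows R d 1 1 ltr01 ltr01.
exists N => K n x a [_ symK _ _] [Kx xa off]; rewrite leqNgt; apply/negP => nN.
pose Y := \matrix_i x i; pose G := (\matrix_i a i)^T.
have YG i k : (Y *m G) i k = dot (x i) (a k).
  by rewrite dotE mxE; apply: eq_bigr => j _; rewrite !mxE.
have [|i [j [ij /(_ i)]]] := HN n n Y G nN.
  move=> i k; rewrite YG ler_norml (supports_ge symK (xa k)) //=.
  by case: (xa k) => _; apply.
rewrite !YG (xa i).1; have := off j i; rewrite eq_sym ij => /(_ isT) H.
by rewrite ltr_norml => /andP[_]; lra.
Qed.

Section Body.
Variables (d : nat) (K : set 'rV[R]_d).
Hypothesis regK : regular_body K.

Lemma Hsep_sizesP n : Hsep_sizes K n <-> exists x a, @sep_system R d K n x a.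
Proof.
split=> [[t /(config_sep_system regK)[x [a [sys _]]]]|[x [a sys]]].
  by exists x, a.
by exists (fun i => 2 *: x i); apply: sep_system_config sys.
Qed.

Lemma hsep_sizesP n : hsep_sizes K n <-> exists x a,
  [/\ @sep_system R d K n x a, ~ conv_hull x 0 & ~ conv_hull a 0].
Proof.
split=> [[x /(one_sided_sep_system regK)[a]]|[x [a sys]]]; first by exists x, a.
by exists x; apply/(one_sided_sep_system regK); exists a.
Qed.

Lemma hsep_sub_Hsep : hsep_sizes K `<=` Hsep_sizes K.
Proof. by move=> n [x [cfg _ _]]; exists (fun i => 2 *: x i). Qed.

Lemma hsep_sizes0 : hsep_sizes K 0%N.
Proof.
apply/hsep_sizesP; exists (fun=> 0), (fun=> 0); split; first by split=> [[]|[]|[]].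
all: by move=> [w [_ + _]]; rewrite big_ord0 => /esym/eqP; rewrite oner_eq0.
Qed.

Lemma Hsep_bodyP : is_max (Hsep_sizes K) (Hsep_body K).
Proof.
have [N HN] := sep_system_bounded d.
apply: (nat_maxP (N := N)); first by exists 0%N; apply/hsep_sub_Hsep/hsep_sizes0.
by move=> m /Hsep_sizesP[x [a]]; apply: HN.
Qed.

Lemma hsep_bodyP : is_max (hsep_sizes K) (hsep_body K).
Proof.
apply: (nat_maxP (N := Hsep_body K)); first by exists 0%N; apply: hsep_sizes0.
by move=> m /hsep_sub_Hsep; case: Hsep_bodyP => _; apply.
Qed.

Lemma hsep_body_le_Hsep_body : (hsep_body K <= Hsep_body K)%N.
Proof. by case: Hsep_bodyP => _; apply; apply: hsep_sub_Hsep; case: hsep_bodyP. Qed.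

End Body.

Lemma HsepP d : (0 < d)%N -> is_max (Hsep_values R d) (Hsep R d).
Proof.
move=> d0; rewrite /Hsep gtn_eqF //.
have [N HN] := sep_system_bounded d.
apply: (nat_maxP (N := N)).
  by exists (Hsep_body (unit_ball R d)), (unit_ball R d) => //; apply: unit_ball_regular.
move=> _ [K regK <-]; have [/(Hsep_sizesP regK)[x [a sys]] _] := Hsep_bodyP regK.
exact: HN sys.
Qed.

Lemma hsepP d : (0 < d)%N -> is_max (hsep_values R d) (hsep R d).
Proof.
move=> d0; rewrite /hsep gtn_eqF //.
apply: (nat_maxP (N := Hsep R d)).
  by exists (hsep_body (unit_ball R d)), (unit_ball R d) => //; apply: unit_ball_regular.
move=> _ [K regK <-]; apply: leq_trans (hsep_body_le_Hsep_body regK) _.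
by case: (HsepP d0) => _; apply; exists K.
Qed.

Lemma hsep_le_Hsep d : (0 < d)%N -> (hsep R d <= Hsep R d)%N.
Proof.
move=> d0; have [[K regK <-] _] := hsepP d0.
apply: leq_trans (hsep_body_le_Hsep_body regK) _.
by case: (HsepP d0) => _; apply; exists K.
Qed.

Definition Hsep_bound d := (\max_(l < d.+1) (2 * l + hsep R (d - l)))%N.

(** The index [l] of the bound in dimension [r] becomes [d - r + l] in
    dimension [d]. *)
Lemma Hsep_bound_shift r d : (r <= d)%N ->
  (2 * (d - r) + Hsep_bound r <= Hsep_bound d)%N.
Proof.
move=> rd; have [l ->] : exists l : 'I_r.+1,
    Hsep_bound r = (2 * l + hsep R (r - l))%N.
  by exists [arg max_(l > ord0) (2 * l + hsep R (r - l))%N]; apply: bigmax_eq_arg.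
have ld : (d - r + l < d.+1)%N by have := ltn_ord l; lia.
have := @leq_bigmax _ (fun l : 'I_d.+1 => 2 * l + hsep R (d - l))%N (Ordinal ld).
rewrite /= -/(Hsep_bound d); apply: leq_trans.
have -> : (d - (d - r + l) = r - l)%N by have := ltn_ord l; lia.
by rewrite mulnDr addnA.
Qed.

(** Unless the system is one-sided, [orthogonal_reduction] removes at most
    [2 (d - r)] of its members and the remaining ones live in dimension [r]: on a
    projection of [K] when the origin is in the hull of the [x_i], and on a
    section when it is in the hull of the [a_i]. *)
Lemma sep_system_size_le d (K : set 'rV[R]_d) n (x a : 'I_n -> 'rV[R]_d) :
  regular_body K -> sep_system K x a -> (n <= Hsep_bound d)%N.
Proof.
elim/ltn_ind: d K n x a => d IH K n x a regK sys; have [Kx xa off] := sys.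
have split_size (T : {pred 'I_n}) r : (r < d)%N -> (#|T| <= 2 * (d - r))%N ->
    (#|[predC T]| <= Hsep_bound r)%N -> (n <= Hsep_bound d)%N.
  move=> rd T1 T2; have := Hsep_bound_shift (ltnW rd).
  by apply: leq_trans; rewrite -[X in (X <= _)%N]card_ord -(cardC T) leq_add.
pose g (T : {pred 'I_n}) (i : 'I_#|[predC T]|) := enum_val i.
have sysg T : sep_system K (x \o g T) (a \o g T).
  by apply: sep_system_reindex => //; apply: enum_val_inj.
have gT T i : g T i \notin T by have := enum_valP i.
have [hx|nx] := pselect (conv_hull x 0).
  have [T [r [B [b [freeB rd Tle bE]]]]] :=
    orthogonal_reduction (fun i => (xa i).1) off hx.
  apply: (split_size T r) => //.
  apply: (IH r rd (projection_body K B) _ _ (b \o g T)).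
    exact: projection_body_regular.
  apply: sep_system_projection.
  rewrite (_ : (fun i => _) = a \o g T); first exact: sysg.
  by apply/funext => i; rewrite /= -bE // gT.
have [ha|na] := pselect (conv_hull a 0).
  have diag i : dot (a i) (x i) = 1 by rewrite dotC (xa i).1.
  have off' i j : i != j -> dot (a i) (x j) <= 0.
    by move=> ij; rewrite dotC off // eq_sym.
  have [T [r [B [b [freeB rd Tle bE]]]]] := orthogonal_reduction diag off' ha.
  apply: (split_size T r) => //.
  apply: (IH r rd (section_body K B) _ (b \o g T) (fun i => (a \o g T) i *m B^T)).
    exact: section_body_regular.
  apply: sep_system_section.
  rewrite (_ : (fun i => _) = x \o g T); first exact: sysg.
  by apply/funext => i; rewrite /= -bE // gT.
have [d0|d0] := posnP d.
  have [->//|n0] := posnP n; have := (xa (Ordinal n0)).1.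
  rewrite dotE big1; first by move=> /esym/eqP; rewrite oner_eq0.
  by move=> [j jd]; exfalso; rewrite d0 in jd.
have n_size : hsep_sizes K n by apply/(hsep_sizesP regK); exists x, a.
apply: leq_trans (_ : (hsep R d <= _)%N).
  apply: leq_trans ((hsep_bodyP regK).2 _ n_size) _.
  by apply: (hsepP d0).2; exists K.
have := @leq_bigmax _ (fun l : 'I_d.+1 => 2 * l + hsep R (d - l))%N ord0.
by rewrite /= subn0.
Qed.

Lemma Hsep_le d : (0 < d)%N -> (Hsep R d <= Hsep_bound d)%N.
Proof.
move=> d0; have [[K regK <-] _] := HsepP d0.
have [/(Hsep_sizesP regK)[x [a sys]] _] := Hsep_bodyP regK.
exact: sep_system_size_le sys.
Qed.

(** Realised by the standard basis, each vector being its own supporting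
    functional. *)
Lemma hsep_sizes_unit_ball d : hsep_sizes (unit_ball R d) d.
Proof.
pose e (i : 'I_d) : 'rV[R]_d := delta_mx 0 i.
have dote i y : dot y (e i) = y 0 i.
  by rewrite /dot trmx_delta -colE mxE.
have eball i : unit_ball R d (e i).
  by apply/unit_ballE; rewrite dote mxE !eqxx.
apply/(hsep_sizesP (unit_ball_regular R d)); exists e, e.
have ne : ~ conv_hull e 0.
  move=> [w [_ w1 wE]]; have : \sum_i w i = 0.
    apply: big1 => i _; rewrite -(dot0l (e i)) wE dot_suml (bigD1 i) //=.
    rewrite dotZl dote mxE !eqxx mulr1 big1 ?addr0 // => j ji.
    by rewrite dotZl dote mxE eqxx eq_sym (negbTE ji) mulr0.
  by rewrite w1 => /eqP; rewrite oner_eq0.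
split=> //; split=> // [i|i j ij].
  split; first by rewrite dote mxE !eqxx.
  move=> y /unit_ballE y1; have /unit_ballE e1 := eball i.
  by have := dot_distance y (e i); lra.
by rewrite dote mxE eqxx eq_sym (negbTE ij).
Qed.

Lemma hsep_body_unit_ball d : hsep_body (unit_ball R d) = d.
Proof.
have regB := unit_ball_regular R d.
apply: nat_max_eq; split; first exact: hsep_sizes_unit_ball.
move=> n /(hsep_sizesP regB)[x [a [[Bx xa off] nx _]]].
apply: (obtuse_size_le (x := x)) => // i j ij.
by rewrite -(ball_supports (Bx j) (xa j)) off.
Qed.

Lemma hsep_low_dim d : (0 < d <= 4)%N -> hsep R d = d.
Proof.
move=> /andP[d0 d4]; apply/eqP; rewrite eqn_leq; apply/andP; split.
  have [[K regK <-] _] := hsepP d0.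
  have [/(hsep_sizesP regK)[x [a [sys nx _]]] _] := hsep_bodyP regK.
  exact: sep_system_size_le_dim d4 sys nx.
rewrite -{1}(hsep_body_unit_ball d); apply: (hsepP d0).2.
by exists (unit_ball R d) => //; apply: unit_ball_regular.
Qed.

End Numbers.

(* The first conjunct says that the maxima defining the Hadwiger numbers exist,
   so that none of them takes the default value of [nat_max]. *)
Theorem theorem2 (R : realType) :
  [/\ forall d : nat, (0 < d)%N ->
        [/\ forall K : set 'rV[R]_d, regular_body K ->
              is_max (Hsep_sizes K) (Hsep_body K) /\
              is_max (hsep_sizes K) (hsep_body K),
            is_max (Hsep_values R d) (Hsep R d) &
            is_max (hsep_values R d) (hsep R d)],
      forall d : nat, (0 < d)%N ->
        (hsep R d <= Hsep R d)%N /\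
        (Hsep R d <= \max_(l < d.+1) (2 * l + hsep R (d - l)))%N,
      forall d : nat, d \in [:: 1; 2; 3; 4]%N -> hsep R d = d &
      forall d : nat, (0 < d)%N -> hsep_body (unit_ball R d) = d].
Proof.
split.
- move=> d d0; split; [|exact: HsepP|exact: hsepP].
  by move=> K regK; split; [exact: Hsep_bodyP|exact: hsep_bodyP].
- by move=> d d0; split; [exact: hsep_le_Hsep|exact: Hsep_le].
- by move=> d; rewrite !inE => d14; apply: hsep_low_dim; lia.
- by move=> d _; apply: hsep_body_unit_ball.
Qed.
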